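(* Assume that the parameter $\epsilon$ used in the active-set estimate satisfies $0<\epsilon\le \frac{1}{\tau^2 n L(2C+1)}$, where $C>0$ is a given constant. Let $\{x^k\}$ be the sequence of points produced by the algorithm AS-$\ell_1$ (described in the context) applied to the problem $\min\{\varphi(x) : x\in\mathbb{R}^n,\ \|x\|_1\le\tau\}$. Then every limit point $x^*$ of $\{x^k\}$ is a stationary point of this problem.
   Context: **Problem.** $\varphi\colon\mathbb{R}^n\to\mathbb{R}$ is a differentiable function whose gradient is Lipschitz continuous with constant $L>0$ (w.r.t. the Euclidean norm $\|\cdot\|$), $\tau>0$, and the problem is $\min \varphi(x)$ subject to $\|x\|_1\le\tau$. $e_i$ denotes the $i$-th canonical vector of $\mathbb{R}^n$. **Stationarity.** A feasible point $x^*$ is stationary iff $\nabla\varphi(x^* )^T(\tau e_i-x^* )\ge 0$ and $\nabla\varphi(x^* )^T(-\tau e_i-x^* )\ge 0$ for all $i=1,\dots,n$. **Active-set estimate.** For $\epsilon>0$ and feasible $x$, $A_{\ell_1}(x)$ is the set of $i\in\{1,\dots,n\}$ such that $$\epsilon\tau\nabla\varphi(x)^T(\tau e_i+x)\le 0\le x_i\le \epsilon\tau\nabla\varphi(x)^T(\tau e_i-x)\quad\text{or}\quad \epsilon\tau\nabla\varphi(x)^T(\tau e_i+x)\le x_i\le 0\le \epsilon\tau\nabla\varphi(x)^T(\tau e_i-x),$$ and $N_{\ell_1}(x)=\{1,\dots,n\}\setminus A_{\ell_1}(x)$. Moreover $J_{\ell_1}(x)=\{j : j\in\operatorname{Argmax}_{i=1,\dots,n}|\nabla_i\varphi(x)|\}$.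 **Algorithm AS-$\ell_1$.** Fixed parameters: $\epsilon>0$, $\delta\in(0,1)$, $\gamma\in(0,1)$, an integer $n_m>0$, and constants $0<\underline m\le\overline m<\infty$. Choose a feasible $x^0$. For $k=0,1,\dots$: 1. If $x^k$ is stationary, stop. 2. Set $A^k=A_{\ell_1}(x^k)$, $N^k=N_{\ell_1}(x^k)$; choose $j\in J_{\ell_1}(x^k)$ and put $\tilde N^k=N^k\setminus\{j\}$. 3. Define $\tilde x^k$ by $\tilde x^k_i=0$ for $i\in A^k$, $\tilde x^k_i=x^k_i$ for $i\in\tilde N^k$, and $\tilde x^k_j=x^k_j-\operatorname{sgn}(\nabla_j\varphi(x^k))\sum_{h\in A^k}|x^k_h|$. 4. Let $\mathcal{B}_{N^k}=\{x\in\mathbb{R}^n:\|x\|_1\le\tau,\ x_i=0\ \forall i\notin N^k\}$, choose any $m^k\in[\underline m,\overline m]$, let $\hat x^k$ be the Euclidean projection of $\tilde x^k-m^k\nabla\varphi(\tilde x^k)$ onto $\mathcal{B}_{N^k}$, and define $d^k$ by $d^k_i=0$ for $i\in A^k$ and $d^k_i=\hat x^k_i-\tilde x^k_i$ for $i\in N^k$. 5. Line search: set $\bar\varphi^k=\max_{0\le i\le\min\{n_m,k\}}\varphi(\tilde x^{k-i})$. If $\nabla\varphi(\tilde x^k)^Td^k<0$, start with $\alpha=1$ and, while $\varphi(\tilde x^k+\alpha d^k)>\bar\varphi^k+\gamma\alpha\nabla\varphi(\tilde x^k)^Td^k$, replace $\alpha$ by $\delta\alpha$; let $\alpha^k$ be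 the final $\alpha$. Otherwise set $\alpha^k=0$. 6. Set $x^{k+1}=\tilde x^k+\alpha^kd^k$. *)

(* Defs.v *)
From HB Require Import structures.
From mathcomp Require Import all_boot all_order all_algebra.
From mathcomp Require Import all_classical all_reals all_analysis.
Set Implicit Arguments.
Unset Strict Implicit.
Unset Printing Implicit Defensive.
Import Order.TTheory GRing.Theory Num.Theory.
Import numFieldNormedType.Exports.
Local Open Scope ring_scope.

(* The library norm on 'rV[R]_n is the sup norm; the Euclidean and l1 norms
   are therefore defined explicitly.  The topologies coincide. *)
Definition dotv (R : realType) (n : nat) (u v : 'rV[R]_n) : R :=
  \sum_(i < n) u 0 i * v 0 i.

Definition norm2 (R : realType) (n : nat) (u : 'rV[R]_n) : R :=
  Num.sqrt (dotv u u).

Definition norm1 (R : realType) (n : nat) (u : 'rV[R]_n) : R :=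
  \sum_(i < n) `|u 0 i|.

Definition canonv (R : realType) (n : nat) (i : 'I_n) : 'rV[R]_n :=
  delta_mx 0 i.
Arguments canonv R {n} i.

Definition grad (R : realType) (n : nat) (phi : 'rV[R]_n -> R)
    (x : 'rV[R]_n) : 'rV[R]_n :=
  \row_(i < n) 'D_(canonv R i) phi x.

Definition feasible (R : realType) (n : nat) (tau : R) (x : 'rV[R]_n) : Prop :=
  norm1 x <= tau.

Definition stationary (R : realType) (n : nat) (phi : 'rV[R]_n -> R) (tau : R)
    (x : 'rV[R]_n) : Prop :=
  feasible tau x /\
  forall i : 'I_n,
    0 <= dotv (grad phi x) (tau *: canonv R i - x) /\
    0 <= dotv (grad phi x) (- (tau *: canonv R i) - x).

Definition active_set (R : realType) (n : nat) (phi : 'rV[R]_n -> R)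
    (tau eps : R) (x : 'rV[R]_n) : {set 'I_n} :=
  finset (fun i : 'I_n =>
    let lo := eps * tau * dotv (grad phi x) (tau *: canonv R i + x) in
    let hi := eps * tau * dotv (grad phi x) (tau *: canonv R i - x) in
    [&& lo <= 0, 0 <= x 0 i & x 0 i <= hi] ||
    [&& lo <= x 0 i, x 0 i <= 0 & 0 <= hi]).

Definition nonactive_set (R : realType) (n : nat) (phi : 'rV[R]_n -> R)
    (tau eps : R) (x : 'rV[R]_n) : {set 'I_n} :=
  (~: active_set phi tau eps x)%SET.

Definition argmax_grad (R : realType) (n : nat) (phi : 'rV[R]_n -> R)
    (x : 'rV[R]_n) : {set 'I_n} :=
  finset (fun j : 'I_n =>
    [forall i : 'I_n, `|grad phi x 0 i| <= `|grad phi x 0 j|]).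

(* The test [i == j] comes first, but at a nonstationary feasible point no
   element of [argmax_grad] is active, so the order of the cases is immaterial
   wherever the algorithm uses this. *)
Definition shifted_point (R : realType) (n : nat) (phi : 'rV[R]_n -> R)
    (tau eps : R) (x : 'rV[R]_n) (j : 'I_n) : 'rV[R]_n :=
  let A := active_set phi tau eps x in
  \row_(i < n)
    if i == j then
      x 0 j - Num.sg (grad phi x 0 j) * \sum_(h in A) `|x 0 h|
    else if i \in A then 0 else x 0 i.

Definition restricted_ball (R : realType) (n : nat) (tau : R)
    (N : {set 'I_n}) : set 'rV[R]_n :=
  [set x | norm1 x <= tau /\ (forall i : 'I_n, i \notin N -> x 0 i = 0)]%classic.

Definition is_projection (R : realType) (n : nat) (B : set 'rV[R]_n)
    (z p : 'rV[R]_n) : Prop :=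
  B p /\ forall y : 'rV[R]_n, B y -> norm2 (p - z) <= norm2 (y - z).

(* The starting value of the big operator is the term of index 0. *)
Definition reference_value (R : realType) (n : nat) (phi : 'rV[R]_n -> R)
    (nm : nat) (xt : nat -> 'rV[R]_n) (k : nat) : R :=
  \big[Num.max/phi (xt k)]_(0 <= i < (minn nm k).+1) phi (xt (k - i)%N).

Definition sufficient_decrease (R : realType) (n : nat) (phi : 'rV[R]_n -> R)
    (gamma phibar : R) (y d : 'rV[R]_n) (alpha : R) : Prop :=
  phi (y + alpha *: d) <= phibar + gamma * alpha * dotv (grad phi y) d.

Definition line_search (R : realType) (n : nat) (phi : 'rV[R]_n -> R)
    (delta gamma phibar : R) (y d : 'rV[R]_n) (alpha : R) : Prop :=
  if dotv (grad phi y) d < 0 then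
    exists h : nat,
      [/\ alpha = delta ^+ h,
          sufficient_decrease phi gamma phibar y d (delta ^+ h)
        & forall l : nat, (l < h)%N ->
            ~ sufficient_decrease phi gamma phibar y d (delta ^+ l)]
  else alpha = 0.

(* One iteration from [x k], which is not stationary, to [x k.+1]; [xt] is the
   sequence of the points x-tilde. *)
Definition as_l1_step (R : realType) (n : nat) (phi : 'rV[R]_n -> R)
    (tau eps delta gamma : R) (nm : nat) (mlo mhi : R)
    (x xt : nat -> 'rV[R]_n) (k : nat) : Prop :=
  exists (j : 'I_n) (m alpha : R) (xhat d : 'rV[R]_n),
    let N := nonactive_set phi tau eps (x k) in
    [/\ j \in argmax_grad phi (x k) /\ xt k = shifted_point phi tau eps (x k) j,
        mlo <= m <= mhi /\
        is_projection (restricted_ball tau N)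
          (xt k - m *: grad phi (xt k)) xhat,
        d = \row_(i < n) (if i \in N then xhat 0 i - xt k 0 i else 0),
        line_search phi delta gamma (reference_value phi nm xt k) (xt k) d alpha
      & x k.+1 = xt k + alpha *: d].

(* A run that stops at [x k] is continued by the constant value [x k], so that
   the point returned by the algorithm is the only limit point of the run. *)
Definition as_l1_sequence (R : realType) (n : nat) (phi : 'rV[R]_n -> R)
    (tau eps delta gamma : R) (nm : nat) (mlo mhi : R)
    (x : nat -> 'rV[R]_n) : Prop :=
  feasible tau (x 0%N) /\
  exists xt : nat -> 'rV[R]_n, forall k : nat,
    (stationary phi tau (x k) -> x k.+1 = x k) /\
    (~ stationary phi tau (x k) ->
       as_l1_step phi tau eps delta gamma nm mlo mhi x xt k).

(* Main.v *)
Require Import Defs.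
From HB Require Import structures.
From mathcomp Require Import all_boot all_order all_algebra.
From mathcomp Require Import all_classical all_reals all_analysis.
From mathcomp Require Import ring lra.
Set Implicit Arguments.
Unset Strict Implicit.
Unset Printing Implicit Defensive.
Import Order.TTheory GRing.Theory Num.Theory.
Import numFieldNormedType.Exports.
Local Open Scope ring_scope.

(* Moving the active coordinates to zero and compensating in a coordinate of
   largest gradient gives phi (xt k) <= phi (x k) - C L |xt k - x k|^2.  The
   projected direction satisfies m (grad . d) <= - |d|^2, and the descent lemma
   bounds the accepted step sizes from below, so the line search gains a multiple
   of |d|^2 over the maximum of the last values of phi (xt _).  The usual
   nonmonotone argument then makes |d k| and |xt k - x k| tend to 0.  Finally each
   quantity grad phi (x k) . (+- tau e_i - x k) is nonnegative when i is active, by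
   the active-set inequalities, and bounded below by a multiple of
   - (|d k| + |xt k - x k|) when it is not, by the variational inequality of the
   projection; no subsequence with a constant active set is needed. *)

(** * Inner product, Euclidean norm and l1 norm *)

Lemma dotvC (R : realType) (n : nat) (u v : 'rV[R]_n) : dotv u v = dotv v u.
Proof. by apply: eq_bigr => i _; rewrite mulrC. Qed.

Lemma dotvDl (R : realType) (n : nat) (u v w : 'rV[R]_n) :
  dotv (u + v) w = dotv u w + dotv v w.
Proof. by rewrite -big_split; apply: eq_bigr => i _; rewrite mxE mulrDl. Qed.

Lemma dotvZl (R : realType) (n : nat) (a : R) (u v : 'rV[R]_n) :
  dotv (a *: u) v = a * dotv u v.
Proof. by rewrite mulr_sumr; apply: eq_bigr => i _; rewrite mxE mulrA. Qed.

Lemma dotvNl (R : realType) (n : nat) (u v : 'rV[R]_n) :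
  dotv (- u) v = - dotv u v.
Proof. by rewrite -scaleN1r dotvZl mulN1r. Qed.

Lemma dotvDr (R : realType) (n : nat) (u v w : 'rV[R]_n) :
  dotv w (u + v) = dotv w u + dotv w v.
Proof. by rewrite dotvC dotvDl !(dotvC w). Qed.

Lemma dotvZr (R : realType) (n : nat) (a : R) (u v : 'rV[R]_n) :
  dotv v (a *: u) = a * dotv v u.
Proof. by rewrite dotvC dotvZl dotvC. Qed.

Lemma dotvNr (R : realType) (n : nat) (u v : 'rV[R]_n) :
  dotv v (- u) = - dotv v u.
Proof. by rewrite dotvC dotvNl dotvC. Qed.

Definition dotvE := (dotvDl, dotvDr, dotvNl, dotvNr, dotvZl, dotvZr).

Lemma dotv_canonv (R : realType) (n : nat) (u : 'rV[R]_n) (i : 'I_n) :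
  dotv u (canonv R i) = u 0 i.
Proof.
rewrite /dotv (bigD1 i) //= mxE !eqxx mulr1 big1 ?addr0 // => k ki.
by rewrite mxE (negbTE ki) andbF mulr0.
Qed.

Lemma dotvv_ge0 (R : realType) (n : nat) (u : 'rV[R]_n) : 0 <= dotv u u.
Proof. by apply: sumr_ge0 => i _; rewrite -expr2 sqr_ge0. Qed.

Lemma norm2_ge0 (R : realType) (n : nat) (u : 'rV[R]_n) : 0 <= norm2 u.
Proof. exact: sqrtr_ge0. Qed.
#[local] Hint Extern 0 (is_true (0 <= dotv _ _)) => exact: dotvv_ge0 : core.
#[local] Hint Extern 0 (is_true (0 <= norm2 _)) => exact: norm2_ge0 : core.

Lemma norm2_sqr (R : realType) (n : nat) (u : 'rV[R]_n) :
  norm2 u ^+ 2 = dotv u u.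
Proof. by rewrite sqr_sqrtr ?dotvv_ge0. Qed.

Lemma norm2_eq0 (R : realType) (n : nat) (u : 'rV[R]_n) :
  norm2 u = 0 -> u = 0.
Proof.
move=> u0; have uu : dotv u u = 0 by rewrite -norm2_sqr u0 expr0n.
apply/rowP => i; rewrite mxE; apply/eqP; rewrite -sqrf_eq0 expr2; apply/eqP.
by apply: (psumr_eq0P _ uu) => // k _; rewrite -expr2 sqr_ge0.
Qed.

(** Expand the squared norms of [norm2 v *: u + norm2 u *: v] and of the corresponding difference;
    once zero vectors are set aside, the common factor [2 * (norm2 u * norm2 v)] cancels. *)
Lemma cauchy_schwarz (R : realType) (n : nat) (u v : 'rV[R]_n) :
  `|dotv u v| <= norm2 u * norm2 v.
Proof.
have [/norm2_eq0 ->|u0] := eqVneq (norm2 u) 0.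
  by rewrite -(scale0r v) dotvZl mul0r normr0 mulr_ge0.
have [/norm2_eq0 ->|v0] := eqVneq (norm2 v) 0.
  by rewrite -(scale0r u) dotvZr mul0r normr0 mulr_ge0.
have up : 0 < norm2 u by rewrite lt_def u0 norm2_ge0.
have vp : 0 < norm2 v by rewrite lt_def v0 norm2_ge0.
have uu := norm2_sqr u; have vv := norm2_sqr v.
have uv : 0 < 2 * (norm2 u * norm2 v) by rewrite !mulr_gt0.
rewrite ler_norml; apply/andP; split; rewrite -subr_ge0 -(pmulr_rge0 _ uv).
  have := dotvv_ge0 (norm2 v *: u + norm2 u *: v).
  by rewrite !dotvE (dotvC v u) -uu -vv; congr (0 <= _); ring.
have := dotvv_ge0 (norm2 v *: u - norm2 u *: v).
by rewrite !dotvE (dotvC v u) -uu -vv; congr (0 <= _); ring.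
Qed.

Lemma dotv_le (R : realType) (n : nat) (u v : 'rV[R]_n) :
  dotv u v <= norm2 u * norm2 v.
Proof. exact: le_trans (ler_norm _) (cauchy_schwarz u v). Qed.

Lemma norm2N (R : realType) (n : nat) (u : 'rV[R]_n) : norm2 (- u) = norm2 u.
Proof. by rewrite /norm2 dotvNl dotvNr opprK. Qed.

Lemma norm2D (R : realType) (n : nat) (u v : 'rV[R]_n) :
  norm2 (u + v) <= norm2 u + norm2 v.
Proof.
rewrite -[leRHS]ger0_norm ?addr_ge0 // -[leRHS]sqrtr_sqr ler_wsqrtr //.
rewrite sqrrD !norm2_sqr !dotvE (dotvC v u).
by have := dotv_le u v; lra.
Qed.

Lemma norm1_ge0 (R : realType) (n : nat) (u : 'rV[R]_n) : 0 <= norm1 u.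
Proof. exact: sumr_ge0. Qed.

Lemma norm1D (R : realType) (n : nat) (u v : 'rV[R]_n) :
  norm1 (u + v) <= norm1 u + norm1 v.
Proof.
by rewrite -big_split; apply: ler_sum => i _; rewrite mxE ler_normD.
Qed.

Lemma norm1Z (R : realType) (n : nat) (a : R) (u : 'rV[R]_n) :
  norm1 (a *: u) = `|a| * norm1 u.
Proof. by rewrite mulr_sumr; apply: eq_bigr => i _; rewrite mxE normrM. Qed.

Lemma norm1N (R : realType) (n : nat) (u : 'rV[R]_n) : norm1 (- u) = norm1 u.
Proof. by rewrite -scaleN1r norm1Z normrN1 mul1r. Qed.

Lemma norm1_canonv (R : realType) (n : nat) (i : 'I_n) :
  norm1 (canonv R i) = 1.
Proof.
rewrite /norm1 (bigD1 i) //= mxE !eqxx normr1 big1 ?addr0 // => k ki.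
by rewrite mxE (negbTE ki) andbF normr0.
Qed.

Lemma norm2_le_norm1 (R : realType) (n : nat) (u : 'rV[R]_n) :
  norm2 u <= norm1 u.
Proof.
rewrite -[leRHS]ger0_norm ?norm1_ge0 // -[leRHS]sqrtr_sqr ler_wsqrtr //.
rewrite expr2 {1}/norm1 mulr_suml; apply: ler_sum => i _.
rewrite -expr2 -real_normK ?num_real // expr2 ler_wpM2l //.
by rewrite /norm1 (bigD1 i) //= lerDl sumr_ge0.
Qed.

(** * Geometry of the feasible ball *)

Lemma feasible_segment (R : realType) (n : nat) (tau : R) (u v : 'rV[R]_n)
    (t : R) :
  0 <= t <= 1 -> feasible tau u -> feasible tau v ->
  feasible tau (u + t *: (v - u)).
Proof.
move=> /andP[t0 t1] fu fv; rewrite /feasible in fu fv *.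
have -> : u + t *: (v - u) = (1 - t) *: u + t *: v.
  by rewrite scalerBr scalerBl scale1r addrA addrAC.
apply: le_trans (norm1D _ _) _; rewrite !norm1Z !ger0_norm ?subr_ge0 //.
by nra.
Qed.

Lemma norm2_subr_feasible (R : realType) (n : nat) (tau : R) (u v : 'rV[R]_n) :
  feasible tau u -> feasible tau v -> norm2 (u - v) <= 2 * tau.
Proof.
move=> fu fv; apply: le_trans (norm2D _ _) _; rewrite norm2N.
rewrite mulr_natl; apply: lerD; exact: le_trans (norm2_le_norm1 _) _.
Qed.

Lemma feasible_vertex (R : realType) (n : nat) (tau : R) (i : 'I_n) :
  0 < tau -> feasible tau (tau *: canonv R i) /\
             feasible tau (- (tau *: canonv R i)).
Proof.
by move=> t0; rewrite /feasible norm1N norm1Z norm1_canonv mulr1 gtr0_norm.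
Qed.

(** * Gradients, the descent lemma and Lipschitz bounds *)

Lemma derive_grad (R : realType) (n : nat) (phi : 'rV[R]_n -> R)
    (y d : 'rV[R]_n) :
  differentiable phi y -> 'D_d phi y = dotv (grad phi y) d.
Proof.
move=> dy; rewrite deriveE // {1}(row_sum_delta d) linear_sum.
apply: eq_bigr => i _.
by rewrite linearZ mxE /= deriveE // mulrC.
Qed.

Lemma is_derive_line (R : realType) (n : nat) (phi : 'rV[R]_n -> R)
    (y d : 'rV[R]_n) (t : R) :
  (forall z, differentiable phi z) ->
  is_derive t 1 (fun s : R => phi (y + s *: d))
            (dotv (grad phi (y + t *: d)) d).
Proof.
move=> dphi; rewrite -derive_grad //.
have E : (fun h : R => h^-1 *: (((fun s : R => phi (y + s *: d)) \o shift t)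
             (h *: 1) - phi (y + t *: d))) =
         (fun h : R => h^-1 *: ((phi \o shift (y + t *: d)) (h *: d)
             - phi (y + t *: d))).
  apply/funext => h /=; congr (_ *: (phi _ - _)).
  by rewrite [h *: 1]mulr1 scalerDl addrCA.
have D : derivable phi (y + t *: d) d by exact: diff_derivable.
by split; rewrite /derivable /derive E.
Qed.

(** Subtract the quadratic [a * t + b * t ^+ 2] from [phi] along the segment and apply the mean
    value theorem on [0, 1]: by the Lipschitz bound, the derivative [df] is nonpositive at the
    intermediate point. *)
Lemma descent_lemma (R : realType) (n : nat) (phi : 'rV[R]_n -> R) (L : R)
    (y d : 'rV[R]_n) :
  (forall z, differentiable phi z) ->
  (forall u v, norm2 (grad phi u - grad phi v) <= L * norm2 (u - v)) ->
  phi (y + d) <= phi y + dotv (grad phi y) d + L / 2 * norm2 d ^+ 2.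
Proof.
move=> dphi lip.
set a := dotv (grad phi y) d; set b := L / 2 * norm2 d ^+ 2.
pose f (t : R) := phi (y + t *: d) - (a * t + b * t ^+ 2).
pose df (t : R) := dotv (grad phi (y + t *: d)) d - (a + b * (2 * t)).
have fD (t : R) : is_derive t 1 f (df t).
  apply: is_deriveB; first exact: is_derive_line.
  apply: is_deriveD.
    have := is_deriveZ a (is_derive_id t (1 : R)).
    by rewrite [a *: 1]mulr1.
  have := is_deriveZ b (is_deriveX 2 (is_derive_id t (1 : R))).
  by rewrite [_ *: 1]mulr1.
have fc : {within `[0, 1], continuous f}%classic.
  by apply: derivable_within_continuous => t _; case: (fD t).
have [c c01] := MVT ltr01 (fun t _ => fD t) fc.
rewrite /f /df scale1r scale0r addr0 subr0 mulr1 => E.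
suff : dotv (grad phi (y + c *: d)) d - a <= b * (2 * c) by move: E; lra.
move: c01; rewrite in_itv /= => /andP[c0 _].
rewrite /a -dotvNl -dotvDl; apply: le_trans (dotv_le _ _) _.
apply: le_trans (ler_wpM2r _ (lip _ _)) _ => //.
have -> : y + c *: d - y = c *: d by rewrite addrAC subrr add0r.
rewrite /norm2 dotvZl dotvZr mulrA -expr2 sqrtrM ?sqr_ge0 //.
by rewrite sqrtr_sqr gtr0_norm // -/(norm2 d) /b; lra.
Qed.

Lemma norm2_grad_feasible (R : realType) (n : nat) (phi : 'rV[R]_n -> R)
    (L tau : R) (y : 'rV[R]_n) :
  0 <= L ->
  (forall u v, norm2 (grad phi u - grad phi v) <= L * norm2 (u - v)) ->
  feasible tau y -> norm2 (grad phi y) <= norm2 (grad phi 0) + L * tau.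
Proof.
move=> L0 lip fy; rewrite -{1}(subrK (grad phi 0) (grad phi y)) addrC.
apply: le_trans (norm2D _ _) _; rewrite lerD2l.
apply: le_trans (lip _ _) _; rewrite subr0 ler_wpM2l //.
exact: le_trans (norm2_le_norm1 _) fy.
Qed.

(** The descent lemma contributes the gradient bound [norm2 (grad phi 0) + L * tau], and its
    quadratic term another [L * tau] because the ball has diameter at most [2 * tau]. *)
Lemma feasible_lipschitz (R : realType) (n : nat) (phi : 'rV[R]_n -> R)
    (L tau : R) (u v : 'rV[R]_n) :
  (forall z, differentiable phi z) -> 0 <= L ->
  (forall u v, norm2 (grad phi u - grad phi v) <= L * norm2 (u - v)) ->
  feasible tau u -> feasible tau v ->
  `|phi u - phi v| <= (norm2 (grad phi 0) + 2 * L * tau) * norm2 (u - v).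
Proof.
move=> dphi L0 lip.
wlog suff H : u v / feasible tau u -> feasible tau v ->
    phi u - phi v <= (norm2 (grad phi 0) + 2 * L * tau) * norm2 (u - v).
  move=> fu fv; rewrite ler_norml; have := H _ _ fu fv; have := H _ _ fv fu.
  by rewrite -(norm2N (v - u)) opprB; lra.
move=> fu fv; have := descent_lemma v (u - v) dphi lip; rewrite addrC subrK.
have := dotv_le (grad phi v) (u - v).
have := norm2_grad_feasible L0 lip fv.
have := norm2_subr_feasible fu fv.
set r := norm2 (u - v); set G := norm2 (grad phi v) => r2 G1 dot ph.
have r0 : 0 <= r := norm2_ge0 _.
have : G * r <= (norm2 (grad phi 0) + L * tau) * r by rewrite ler_wpM2r.
have : (L / 2) * (r * r) <= L / 2 * (2 * tau * r).
  by rewrite ler_wpM2l ?divr_ge0 // ler_wpM2r.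
by rewrite expr2 in ph; lra.
Qed.

(** * First-order inequalities on the feasible set *)

Lemma projection_variational (R : realType) (n : nat) (B : set 'rV[R]_n)
    (z p y : 'rV[R]_n) :
  (forall t : R, 0 <= t <= 1 -> B (p + t *: (y - p))) ->
  is_projection B z p -> 0 <= dotv (p - z) (y - p).
Proof.
move=> conv [Bp pmin]; rewrite leNgt; apply/negP => s0.
set s := dotv (p - z) (y - p) in s0; set q := dotv (y - p) (y - p).
have q0 : 0 <= q := dotvv_ge0 _.
(* The squared distance to [z] changes by [t * (2 * s + t * q)] along the segment. This [t] gives
   [t * q <= - s], hence a strict decrease; the [+ 1] covers [q = 0]. *)
pose t := Num.min 1 (- s / (q + 1)).
have t0 : 0 < t by rewrite lt_min ltr01 divr_gt0 ?oppr_gt0 // ltr_wpDl.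
have t1 : t <= 1 by rewrite ge_min lexx.
have tq : t * q <= - s.
  apply: (@le_trans _ _ (t * (q + 1))); first by rewrite ler_wpM2l ?lerDl ?ltW.
  by rewrite -ler_pdivlMr ?ltr_wpDl // ge_min lexx orbT.
have := pmin _ (conv t _); rewrite ltW ?t1 // => /(_ isT).
rewrite -(ler_pXn2r (n := 2)) // ?nnegrE // !norm2_sqr.
have -> : p + t *: (y - p) - z = (p - z) + t *: (y - p) by rewrite addrAC.
rewrite (dotvDl (p - z)) !(dotvDr (p - z)) (dotvC _ (p - z)) !dotvZl !dotvZr.
rewrite -/s -/q => H.
have : 0 <= t * (2 * s + t * q) by move: H; lra.
by rewrite pmulr_rge0 //; lra.
Qed.

(** The error splits into a change of gradient, paired with a vector of norm at most [2 * tau], and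
    a change of base point, paired with a bounded gradient. It serves both to pass from [xt k] and
    the projection back to [x k], and from iterates to the limit point. *)
Lemma feasible_gradient_gap (R : realType) (n : nat) (phi : 'rV[R]_n -> R)
    (L tau : R) (a a' b b' y : 'rV[R]_n) :
  0 <= L ->
  (forall u v, norm2 (grad phi u - grad phi v) <= L * norm2 (u - v)) ->
  feasible tau a -> feasible tau b' -> feasible tau y ->
  dotv (grad phi a') (y - b') - 2 * tau * L * norm2 (a - a')
    - (norm2 (grad phi 0) + L * tau) * norm2 (b - b')
  <= dotv (grad phi a) (y - b).
Proof.
move=> L0 lip fa fb fy.
have -> : dotv (grad phi a) (y - b) = dotv (grad phi a') (y - b')
    - dotv (grad phi a' - grad phi a) (y - b') - dotv (grad phi a) (b - b').
  by rewrite !dotvE; ring.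
have H1 := dotv_le (grad phi a' - grad phi a) (y - b').
have H2 := dotv_le (grad phi a) (b - b').
have H3 := lip a' a; rewrite -(norm2N (a' - a)) opprB in H3.
have H4 := norm2_grad_feasible L0 lip fa.
have H5 := norm2_subr_feasible fy fb.
have H6 : norm2 (grad phi a' - grad phi a) * norm2 (y - b') <=
  (L * norm2 (a - a')) * (2 * tau) by rewrite ler_pM.
have H7 : norm2 (grad phi a) * norm2 (b - b') <=
  (norm2 (grad phi 0) + L * tau) * norm2 (b - b') by rewrite ler_wpM2r.
by lra.
Qed.

(** * The active-set estimate and the shifted point *)

(** Either alternative in the active-set estimate implies [lo <= 0 <= hi], and these are the two
    sign conditions up to the positive factor [eps * tau]. *)
Lemma active_vertex_dir (R : realType) (n : nat) (phi : 'rV[R]_n -> R)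
    (tau eps : R) (x : 'rV[R]_n) (i : 'I_n) :
  0 < eps * tau -> i \in active_set phi tau eps x ->
  0 <= dotv (grad phi x) (tau *: canonv R i - x) /\
  0 <= dotv (grad phi x) (- (tau *: canonv R i) - x).
Proof.
move=> et; rewrite inE -opprD dotvNr oppr_ge0 /=.
move=> iA; rewrite -(pmulr_rge0 (dotv _ _) et) -(pmulr_rle0 (dotv _ _) et).
by case/orP: iA => /and3P[a b c]; split=> //;
  [exact: le_trans c | exact: le_trans b].
Qed.

(** Hölder's inequality between the l1 and sup norms. *)
Lemma dotv_grad_argmax (R : realType) (n : nat) (phi : 'rV[R]_n -> R)
    (tau : R) (x y : 'rV[R]_n) (j : 'I_n) :
  j \in argmax_grad phi x -> feasible tau y ->
  `|dotv (grad phi x) y| <= tau * `|grad phi x 0 j|.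
Proof.
rewrite inE => /forallP jmax fy.
apply: le_trans (ler_norm_sum _ _ _) _.
apply: le_trans (ler_wpM2r (normr_ge0 _) fy).
rewrite /norm1 mulr_suml; apply: ler_sum => i _.
by rewrite normrM mulrC ler_wpM2l.
Qed.

(** If [j] were active, the two inequalities at [j] would give [tau * |g_j| <= - g.x]; as [|g_j|] is
    the largest component, they would then hold at every index and [x] would be stationary. *)
Lemma argmax_nonactive (R : realType) (n : nat) (phi : 'rV[R]_n -> R)
    (tau eps : R) (x : 'rV[R]_n) (j : 'I_n) :
  0 < tau -> 0 < eps -> feasible tau x -> ~ stationary phi tau x ->
  j \in argmax_grad phi x -> j \notin active_set phi tau eps x.
Proof.
move=> tau0 eps0 fx nst jmax; apply/negP => jA; apply: nst; split=> // i.
have [] := active_vertex_dir (mulr_gt0 eps0 tau0) jA.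
rewrite !dotvE !dotv_canonv.
move: jmax; rewrite inE => /forallP /(_ i).
set gi := grad phi x 0 i; set gj := grad phi x 0 j => gij H1 H2.
have H3 : tau * `|gj| <= - dotv (grad phi x) x.
  by case: (ger0P gj) => _; lra.
have : tau * `|gi| <= tau * `|gj| by rewrite ler_pM2l.
have : tau * gi <= tau * `|gi| by rewrite ler_pM2l // ler_norm.
have : tau * - gi <= tau * `|gi| by rewrite ler_pM2l // -normrN ler_norm.
by move=> *; split; lra.
Qed.

(** Coordinate [j] grows in absolute value by at most the l1 mass removed from the active
    coordinates, which do not include [j]. *)
Lemma shifted_point_feasible (R : realType) (n : nat) (phi : 'rV[R]_n -> R)
    (tau eps : R) (x : 'rV[R]_n) (j : 'I_n) :
  j \notin active_set phi tau eps x -> feasible tau x ->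
  feasible tau (shifted_point phi tau eps x j).
Proof.
set A := active_set phi tau eps x => jA; apply: le_trans.
rewrite /norm1 (bigD1 j) //= mxE eqxx -/A.
rewrite [leRHS](bigID (mem A)) /= [X in _ <= _ + X](bigD1 j) //=.
have -> : \sum_(i < n | i != j) `|shifted_point phi tau eps x j 0 i| =
          \sum_(i < n | (i \notin A) && (i != j)) `|x 0 i|.
  rewrite big_mkcond [RHS]big_mkcond /=; apply: eq_bigr => i _.
  rewrite mxE -/A; case: eqP => ij; rewrite ?andbF //= andbT.
  by case: (i \in A) => //=; rewrite normr0.
rewrite addrA lerD2r addrC; apply: le_trans (ler_normB _ _) _.
rewrite lerD2l normrM -[leRHS]mul1r ler_pM ?sumr_ge0 //.
  by rewrite normr_sg; case: (_ != 0).
by rewrite ger0_norm ?sumr_ge0.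
Qed.

(* The constraint [x_h <= eps tau g.(tau e_h - x)] for [x_h >= 0], or its mirror
   image for [x_h <= 0], forces [g_h] to push [x_h] towards [0], up to
   [|g_j| >= - g.x / tau]. *)
Lemma active_grad_coord (R : realType) (n : nat) (phi : 'rV[R]_n -> R)
    (tau eps : R) (x : 'rV[R]_n) (h j : 'I_n) :
  0 < tau -> 0 < eps -> feasible tau x ->
  j \in argmax_grad phi x -> h \in active_set phi tau eps x ->
  x 0 h ^+ 2 <= eps * tau ^+ 2 *
    (grad phi x 0 h * x 0 h + `|grad phi x 0 j| * `|x 0 h|).
Proof.
move=> tau0 eps0 fx jmax.
have := dotv_grad_argmax jmax fx; rewrite ler_norml inE /=.
rewrite !dotvE !dotv_canonv.
set gx := dotv _ x; set gh := grad phi x 0 h; set gj := `|_|; set xh := x 0 h.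
have et : 0 <= eps * tau by rewrite mulr_ge0 ?ltW.
move=> /andP[lo hi] /orP[] /and3P[a b c].
- have H : eps * tau * (- (tau * gj)) <= eps * tau * gx by rewrite ler_wpM2l.
  have K : 0 <= xh * (eps * tau ^+ 2 * (gh + gj) - xh).
    by rewrite mulr_ge0 // expr2; lra.
  by rewrite (ger0_norm b) expr2; move: K; lra.
- have H : eps * tau * gx >= eps * tau * (- (tau * gj)) by rewrite ler_wpM2l.
  have K : 0 <= - xh * (xh - eps * tau ^+ 2 * (gh - gj)).
    by rewrite mulr_ge0 ?oppr_ge0 // expr2; lra.
  by rewrite (ler0_norm b) expr2; move: K; lra.
Qed.

(** Expand the square and bound each product by half the sum of the two squares. *)
Lemma sqr_sum_le (R : realType) (I : finType) (A : {set I}) (F : I -> R) :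
  (\sum_(h in A) F h) ^+ 2 <= #|A|%:R * \sum_(h in A) F h ^+ 2.
Proof.
rewrite expr2 big_distrlr /=.
apply: (@le_trans _ _
    (\sum_(h in A) \sum_(k in A) (F h ^+ 2 / 2 + F k ^+ 2 / 2))).
  apply: ler_sum => h _; apply: ler_sum => k _.
  by have := sqr_ge0 (F h - F k); rewrite sqrrB; lra.
have E h : \sum_(k in A) (F h ^+ 2 / 2 + F k ^+ 2 / 2) =
    #|A|%:R * (F h ^+ 2 / 2) + (\sum_(k in A) F k ^+ 2) / 2.
  by rewrite big_split /= sumr_const -[_ *+ #|A|]mulr_natl mulr_suml.
rewrite (eq_bigr _ (fun h _ => E h)).
rewrite big_split /= -mulr_sumr sumr_const -mulr_suml -[_ *+ #|A|]mulr_natl.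
by lra.
Qed.

(** Summing [active_grad_coord] over [A] bounds [Q] by the first-order decrease, and the squared
    displacement is at most [n%:R * Q]. The bound on [eps] then makes the first-order decrease at
    least [L * (2 * C + 1)] times the squared displacement, which absorbs the quadratic term of the
    descent lemma. *)
Lemma shifted_point_decrease (R : realType) (n : nat) (phi : 'rV[R]_n -> R)
    (L tau C eps : R) (x : 'rV[R]_n) (j : 'I_n) :
  (forall z, differentiable phi z) ->
  (forall u v, norm2 (grad phi u - grad phi v) <= L * norm2 (u - v)) ->
  0 < L -> 0 < tau -> 0 < C -> 0 < eps ->
  eps <= 1 / (tau ^+ 2 * n%:R * L * (2 * C + 1)) ->
  feasible tau x -> j \in argmax_grad phi x ->
  j \notin active_set phi tau eps x -> grad phi x 0 j != 0 ->
  phi (shifted_point phi tau eps x j) <=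
    phi x - C * L * norm2 (shifted_point phi tau eps x j - x) ^+ 2.
Proof.
move=> dphi lip L0 tau0 C0 eps0 epsle fx jmax jA gj0.
set A := active_set phi tau eps x in jA *.
set xt := shifted_point phi tau eps x j.
pose S : R := \sum_(h in A) `|x 0 h|.
pose Q : R := \sum_(h in A) `|x 0 h| ^+ 2.
have xtE i : (xt - x) 0 i =
    if i == j then - (Num.sg (grad phi x 0 j) * S)
    else if i \in A then - x 0 i else 0.
  rewrite !mxE -/A; case: eqP => [->|_]; first by rewrite addrAC subrr add0r.
  by case: (i \in A); rewrite ?sub0r ?subrr.
have restrict (F : 'I_n -> R) :
    \sum_(i < n | i != j) (if i \in A then F i else 0) = \sum_(i in A) F i.
  rewrite -big_mkcondr; apply: eq_bigl => i.
  by case: eqVneq => //= ->; rewrite (negbTE jA).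
have n2E : norm2 (xt - x) ^+ 2 = S ^+ 2 + Q.
  rewrite norm2_sqr /dotv (bigD1 j) //= xtE eqxx -expr2 sqrrN exprMn.
  rewrite sqr_sg gj0 mul1r; congr (_ + _); rewrite /Q -restrict.
  apply: eq_bigr => i ij; rewrite xtE (negbTE ij).
  by case: (i \in A); rewrite ?mulr0 // mulrNN real_normK ?num_real.
have gE : dotv (grad phi x) (xt - x) =
    - \sum_(h in A) (grad phi x 0 h * x 0 h + `|grad phi x 0 j| * `|x 0 h|).
  rewrite /dotv (bigD1 j) //= xtE eqxx mulrN mulrA.
  rewrite [_ * Num.sg _]mulrC -normrEsg.
  rewrite big_split /= -mulr_sumr opprD addrC; congr (_ - _).
  rewrite -restrict -sumrN; apply: eq_bigr => i ij; rewrite xtE (negbTE ij).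
  by case: (i \in A); rewrite ?mulr0 ?oppr0 // mulrN.
have Qle : Q <= eps * tau ^+ 2 * - dotv (grad phi x) (xt - x).
  rewrite gE opprK mulr_sumr; apply: ler_sum => h hA.
  by rewrite real_normK ?num_real // active_grad_coord.
(* The extra term [Q] in [n2E] raises the factor [#|A|] to [#|A|.+1]; since [j] lies outside [A],
   this still fits in [n]. *)
have cardA : (#|A|.+1 <= n)%N.
  have := max_card (j |: A)%SET.
  by rewrite cardsU1 jA card_ord.
have Q0 : 0 <= Q by apply: sumr_ge0 => h _; rewrite sqr_ge0.
have n2le : norm2 (xt - x) ^+ 2 <= n%:R * Q.
  rewrite n2E; apply: (@le_trans _ _ (#|A|.+1%:R * Q)).
    by rewrite mulrSr mulrDl mul1r lerD2r sqr_sum_le.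
  by rewrite ler_wpM2r // ler_nat.
have n0 : 0 < n%:R :> R by rewrite ltr0n (leq_trans _ cardA).
have k0 : 0 < tau ^+ 2 * n%:R * L * (2 * C + 1).
  by rewrite !mulr_gt0 ?exprn_gt0 // addr_gt0 // mulr_gt0.
rewrite ler_pdivlMr // in epsle.
set r := norm2 (xt - x) ^+ 2 in n2E n2le *.
set D := dotv (grad phi x) (xt - x) in gE Qle.
have D0 : 0 <= - D.
  have := le_trans Q0 Qle; rewrite pmulr_rge0 // mulr_gt0 ?exprn_gt0 //.
have K : L * (2 * C + 1) * r <= - D.
  apply: (@le_trans _ _ (L * (2 * C + 1) * (n%:R * Q))).
    by rewrite ler_wpM2l // mulr_ge0 ?addr_ge0 ?mulr_ge0 // ltW.
  apply: (@le_trans _ _ (L * (2 * C + 1) * (n%:R * (eps * tau ^+ 2 * - D)))).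
    by rewrite ler_wpM2l ?ler_wpM2l // mulr_ge0 ?addr_ge0 ?mulr_ge0 // ltW.
  have := ler_wpM2r D0 epsle; lra.
have r0 : 0 <= L * r by rewrite mulr_ge0 ?exprn_ge0 // ltW.
have C' : 0 <= C * (L * r) by rewrite mulr_ge0 // ltW.
have := descent_lemma x (xt - x) dphi lip.
rewrite [x + _]addrC subrK -/D -/r; lra.
Qed.

(** A zero largest component means a zero gradient, hence stationarity. This ensures that the sign
    in the shift is nonzero, so the removed mass is really moved to coordinate [j]. *)
Lemma argmax_grad_neq0 (R : realType) (n : nat) (phi : 'rV[R]_n -> R)
    (tau : R) (x : 'rV[R]_n) (j : 'I_n) :
  feasible tau x -> ~ stationary phi tau x ->
  j \in argmax_grad phi x -> grad phi x 0 j != 0.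
Proof.
move=> fx nst; rewrite inE => /forallP jmax; apply/eqP => gj0.
have g0 : grad phi x = 0.
  apply/rowP => i; apply/eqP; rewrite [X in _ == X]mxE -normr_le0.
  by rewrite (le_trans (jmax i)) // gj0 normr0.
by apply: nst; split=> // i; rewrite g0 -(scale0r x) !dotvZl !mul0r.
Qed.

(** * The nonmonotone line search *)

(* The limit [l] of the reference values is reached, up to a vanishing error,
   within every window of [nm + 1] consecutive terms.  A term close to [l] has
   a predecessor close to [l], since the decrease and hence [rho] are small
   there; so backwards from such a term the whole window is close to [l]. *)
Lemma nonmonotone_descent_cvg (R : realType) (a rho M : nat -> R) (nm : nat)
    (c K b : R) :
  0 < c -> 0 <= K -> (forall k, 0 <= rho k) -> (forall k, b <= a k) ->
  (forall k, exists2 i, (i <= minn nm k)%N & M k = a (k - i)%N) ->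
  (forall k i, (i <= minn nm k)%N -> a (k - i)%N <= M k) ->
  (forall k, a k.+1 <= M k - c * rho k ^+ 2) ->
  (forall k, `|a k.+1 - a k| <= K * rho k) ->
  forall eta, 0 < eta -> exists k0, forall k, (k0 <= k)%N -> rho k <= eta.
Proof.
move=> c0 K0 rho0 ab Mex Mub dec lip.
have Mdec k : M k.+1 <= M k.
  have [[|i] ile ->] := Mex k.+1.
    rewrite subn0; apply: le_trans (dec k) _.
    by rewrite gerBl mulr_ge0 ?sqr_ge0 // ltW.
  rewrite subSS; apply: Mub; move: ile; rewrite !leq_min ltnS.
  by case/andP => /ltnW -> ->.
have Mmono : {homo M : k l / (k <= l)%N >-> l <= k}.
  by apply: homo_leq => // u v w uv vw; exact: le_trans vw uv.
have Mlb : has_lbound (range M).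
  by exists b => _ [k _ <-]; have [i _ ->] := Mex k.
have Minf : has_inf (range M) by split=> //; exists (M 0%N); exists 0%N.
pose l := inf (range M).
have lM k : l <= M k by apply: ge_inf => //; exists k.
have Ml (eta : R) : 0 < eta ->
    exists k0, forall k, (k0 <= k)%N -> M k <= l + eta.
  move=> eta0; have [_ [k0 _ <-] lt] := inf_adherent eta0 Minf.
  by exists k0 => k /Mmono Mk; apply: le_trans Mk (ltW lt).
have small (eta : R) : 0 < eta -> exists2 theta, 0 < theta & exists k0, 
    forall k, (k0 <= k)%N -> l - theta <= a k.+1 -> rho k <= eta.
  (* From [M k <= l + theta] and [l - theta <= a k.+1], the decrease yields [c * rho k ^+ 2 <= 2 *
     theta = c * eta ^+ 2]. *)
  move=> eta0; pose theta := c * eta ^+ 2 / 2.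
  have theta0 : 0 < theta by rewrite !mulr_gt0 ?exprn_gt0 ?invr_gt0.
  exists theta => //; have [k0 Mk0] := Ml _ theta0; exists k0 => k /Mk0 Mk ak.
  rewrite -(ler_pXn2r (n := 2)) ?nnegrE ?(ltW eta0) // -(ler_pM2l c0).
  by have := dec k; rewrite /theta in ak Mk; lra.
have window j (eta : R) : 0 < eta -> exists k0, forall k i, (k0 <= k)%N ->
    (i <= j)%N -> l <= a (k + i)%N -> l - eta <= a k.
  elim: j eta => [|j IH] eta eta0.
    exists 0%N => k i _; rewrite leqn0 => /eqP ->; rewrite addn0 => lk.
    by apply: le_trans lk; rewrite gerBl ltW.
  (* Half of [eta] pays for the jump [K * rho k] from [k.+1] back to [k], the other half for the
     induction hypothesis; [K + 1] allows [K = 0]. *)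
  have eta2 : 0 < eta / (2 * (K + 1)).
    by rewrite divr_gt0 // mulr_gt0 // ltr_wpDl.
  have [theta theta0 [k1 Hk1]] := small _ eta2.
  have mp : 0 < Num.min theta (eta / 2) by rewrite lt_min theta0 divr_gt0.
  have [k3 Hk3] := IH _ mp; exists (maxn k1 k3).
  move=> k [|i]; rewrite geq_max => /andP[k1k k3k].
    by move=> _; rewrite addn0 => lk; apply: le_trans lk; rewrite gerBl ltW.
  rewrite ltnS -addSnnS => ij lk.
  have ak := Hk3 k.+1 i (leqW k3k) ij lk.
  have mt : Num.min theta (eta / 2) <= theta by rewrite ge_min lexx.
  have me : Num.min theta (eta / 2) <= eta / 2 by rewrite ge_min lexx orbT.
  have rk : rho k <= eta / (2 * (K + 1)).
    by apply: Hk1 => //; apply: le_trans ak; rewrite lerD2l lerN2.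
  have Krk : K * rho k <= eta / 2.
    apply: (@le_trans _ _ ((K + 1) * (eta / (2 * (K + 1))))).
      by rewrite ler_pM // lerDl.
    suff -> : (K + 1) * (eta / (2 * (K + 1))) = eta / 2 by [].
    by field; rewrite gt_eqF // ltr_wpDl.
  by have := lip k; rewrite ler_norml => /andP[_]; lra.
move=> eta eta0; have [theta theta0 [k1 Hk1]] := small _ eta0.
have [k2 Hk2] := window nm _ theta0.
exists (maxn k1 k2) => k; rewrite geq_max => /andP[k1k k2k]; apply: Hk1 => //.
(* The window of length [nm + 1] ending at [k.+1 + nm] starts no earlier than [k.+1], and its
   maximum is at least [l]. *)
have [i ile Mk] := Mex (k.+1 + nm)%N.
apply: (Hk2 k.+1 (nm - i)%N); rewrite ?leq_subr ?leqW //.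
rewrite addnBA; first by rewrite -Mk.
by move: ile; rewrite leq_min => /andP[].
Qed.

Lemma reference_value_ex (R : realType) (n : nat) (phi : 'rV[R]_n -> R)
    (nm : nat) (xt : nat -> 'rV[R]_n) (k : nat) :
  exists2 i, (i <= minn nm k)%N &
    reference_value phi nm xt k = phi (xt (k - i)%N).
Proof.
rewrite /reference_value big_seq.
elim/big_ind: _ => [|u v [i ile ->] [j jle ->]|i].
- by exists 0%N; rewrite ?subn0.
- by rewrite maxEle; case: ifP => _; [exists j | exists i].
- by rewrite mem_index_iota ltnS => /andP[_ ile]; exists i.
Qed.

Lemma reference_value_ge (R : realType) (n : nat) (phi : 'rV[R]_n -> R)
    (nm : nat) (xt : nat -> 'rV[R]_n) (k i : nat) :
  (i <= minn nm k)%N -> phi (xt (k - i)%N) <= reference_value phi nm xt k.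
Proof.
move=> ile; apply: (le_bigmax_seq _ i) => //.
by rewrite mem_index_iota ltnS.
Qed.

(** A rejected trial step [beta] contradicts the descent lemma unless
    [L * m * beta > 2 * (1 - gamma)]; the accepted step is [1] or [delta] times a rejected one,
    hence at least [amin]. *)
Lemma line_search_decrease (R : realType) (n : nat) (phi : 'rV[R]_n -> R)
    (L delta gamma phibar m : R) (y d : 'rV[R]_n) (alpha : R) :
  (forall z, differentiable phi z) ->
  (forall u v, norm2 (grad phi u - grad phi v) <= L * norm2 (u - v)) ->
  0 < L -> 0 < delta < 1 -> 0 < gamma < 1 -> 0 < m ->
  phi y <= phibar -> norm2 d ^+ 2 <= - (m * dotv (grad phi y) d) ->
  line_search phi delta gamma phibar y d alpha ->
  0 <= alpha <= 1 /\
  phi (y + alpha *: d) <= phibar -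
    gamma / m * Num.min 1 (2 * delta * (1 - gamma) / (L * m)) * norm2 d ^+ 2.
Proof.
move=> dphi lip L0 /andP[delta0 delta1] /andP[gamma0 gamma1] m0 yb.
set g := dotv (grad phi y) d; set q := norm2 d ^+ 2 => qg.
have q0 : 0 <= q by rewrite exprn_ge0.
set amin := Num.min _ _; rewrite /line_search -/g; case: ltP => g0.
  move=> [h [-> suff before]]; split.
    by rewrite exprn_ge0 ?exprn_ile1 // ltW.
  have amin_le : amin <= delta ^+ h.
    case: h suff before => [_ _|h _ /(_ h (ltnSn h)) /negP].
      by rewrite expr0 ge_min lexx.
    rewrite /sufficient_decrease -ltNge -/g => fail.
    rewrite ge_min; apply/orP; right; set beta := delta ^+ h in fail *.
    have beta0 : 0 < beta by rewrite exprn_gt0.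
    have := descent_lemma y (beta *: d) dphi lip.
    rewrite norm2_sqr !dotvE -norm2_sqr -/g -/q => desc.
    have H : 0 < beta * ((1 - gamma) * g + L / 2 * beta * q) by lra.
    rewrite pmulr_rgt0 // in H.
    have H2 : (1 - gamma) * q <= (1 - gamma) * - (m * g).
      by rewrite ler_wpM2l // subr_ge0 ltW.
    have H3 : 0 < m * ((1 - gamma) * g + L / 2 * beta * q) by rewrite mulr_gt0.
    have qp : 0 < q.
      rewrite lt_def q0 andbT; apply/eqP => qz; move: H; rewrite qz mulr0 addr0.
      by rewrite ltNge mulr_ge0_le0 ?subr_ge0 ?ltW.
    have H4 : 0 < q * (L * m * beta - 2 * (1 - gamma)) by lra.
    rewrite pmulr_rgt0 // in H4.
    rewrite ler_pdivrMr ?mulr_gt0 // exprS -/beta.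
    have := mulr_gt0 delta0 H4; lra.
  apply: le_trans suff _; rewrite lerD2l -/g.
  have H : amin * q <= delta ^+ h * - (m * g).
    by rewrite ler_pM // le_min ler01 divr_ge0 ?mulr_ge0 ?subr_ge0 // ltW.
  have := ler_wpM2l (ltW (divr_gt0 gamma0 m0)) H.
  have -> : gamma / m * (delta ^+ h * - (m * g)) = - (gamma * delta ^+ h * g).
    by field; rewrite gt_eqF.
  by lra.
(* When the directional derivative is nonnegative, the hypothesis on [norm2 d] forces [q = 0], so
   the null step satisfies the same estimate. *)
move=> ->; rewrite lexx ler01 scale0r addr0; split=> //.
have -> : q = 0.
  by apply/eqP; rewrite eq_le q0 andbT (le_trans qg) // oppr_le0 mulr_ge0 // ltW.
by rewrite mulr0 subr0.
Qed.

(** * Limit points of the iterates *)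

Lemma norm1_le_mx_norm (R : realType) (n : nat) (u : 'rV[R]_n) :
  norm1 u <= n%:R * `|u|.
Proof.
apply: (@le_trans _ _ (\sum_(i < n) `|u|)).
  apply: ler_sum => i _; rewrite [leRHS]mx_normrE.
  by rewrite (le_bigmax_seq _ (0, i)) ?mem_index_enum.
by rewrite sumr_const card_ord mulr_natl.
Qed.

Lemma cluster_norm1 (R : realType) (n : nat) (x : nat -> 'rV[R]_n)
    (xstar : 'rV[R]_n) (theta : R) (k0 : nat) :
  cluster (x @ \oo)%classic xstar -> 0 < theta ->
  exists2 k, (k0 <= k)%N & norm1 (xstar - x k) <= theta.
Proof.
move=> xcl theta0.
have tn : 0 < theta / n.+1%:R by rewrite divr_gt0 ?ltr0n.
(* The tail of the sequence from [k0] on belongs to the filter, so it meets every ball around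
   [xstar]. *)
have [|_ [[k kk0 <-]]] := xcl (x @` [set k | (k0 <= k)%N])%classic _ _
    (nbhsx_ballx xstar _ tn).
  by exists k0 => // k kk0; exists k.
rewrite -ball_normE /= => lt; exists k => //.
apply: le_trans (norm1_le_mx_norm _) _.
apply: (@le_trans _ _ (n.+1%:R * (theta / n.+1%:R))).
  by rewrite ler_pM ?ler_nat // ltW.
by rewrite mulrCA divff ?mulr1.
Qed.

(** For each tolerance a single late iterate near [xstar] suffices: [feasible_gradient_gap]
    transfers its approximate inequality to [xstar], without extracting a subsequence. *)
Lemma cluster_stationary (R : realType) (n : nat) (phi : 'rV[R]_n -> R)
    (L tau : R) (x : nat -> 'rV[R]_n) (xstar : 'rV[R]_n) :
  0 <= L -> 0 < tau ->
  (forall u v, norm2 (grad phi u - grad phi v) <= L * norm2 (u - v)) ->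
  (forall k, feasible tau (x k)) ->
  (forall eta, 0 < eta -> exists k0, forall k, (k0 <= k)%N -> forall i,
    - eta <= dotv (grad phi (x k)) (tau *: canonv R i - x k) /\
    - eta <= dotv (grad phi (x k)) (- (tau *: canonv R i) - x k)) ->
  cluster (x @ \oo)%classic xstar -> stationary phi tau xstar.
Proof.
move=> L0 tau0 lip fx res xcl.
have fxs : feasible tau xstar.
  apply/ler_addgt0Pr => theta theta0.
  have [k _ near] := cluster_norm1 0 xcl theta0.
  rewrite -(subrK (x k) xstar) addrC; apply: le_trans (norm1D _ _) _.
  by rewrite lerD //; exact: fx.
set K := 2 * tau * L + (norm2 (grad phi 0) + L * tau).
have K0 : 0 <= K by rewrite !addr_ge0 ?mulr_ge0 // ltW.
split=> // i.
have close y : feasible tau y ->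
    (forall eta, 0 < eta -> exists k0, forall k, (k0 <= k)%N ->
      - eta <= dotv (grad phi (x k)) (y - x k)) ->
    0 <= dotv (grad phi xstar) (y - xstar).
  move=> fy resy; rewrite -oppr_le0; apply/ler_addgt0Pr => eta eta0.
  rewrite add0r lerNl.
  have eta2 : 0 < eta / 2 by rewrite divr_gt0.
  have [k0 Hk0] := resy _ eta2.
  have [k kk0 near] := cluster_norm1 k0 xcl
    (divr_gt0 eta2 (ltr_wpDl K0 ltr01)).
  have := feasible_gradient_gap (x k) xstar L0 lip fxs (fx k) fy.
  have := Hk0 k kk0.
  have : K * norm2 (xstar - x k) <= eta / 2.
    apply: (@le_trans _ _ ((K + 1) * (eta / 2 / (K + 1)))).
      rewrite ler_pM ?lerDl //; exact: le_trans (norm2_le_norm1 _) near.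
    by rewrite mulrCA divff ?mulr1 // gt_eqF // ltr_wpDl.
  by rewrite /K; lra.
have [fp fm] := feasible_vertex i tau0.
by split; apply: close => // eta /res [k0 Hk0]; exists k0 => k /Hk0 /(_ i) [].
Qed.

(** * Estimates for one iteration *)

Lemma as_l1_step_progress (R : realType) (n : nat) (phi : 'rV[R]_n -> R)
    (L tau C eps delta gamma : R) (nm : nat) (mlo mhi : R)
    (x xt : nat -> 'rV[R]_n) (k : nat) :
  (forall z, differentiable phi z) ->
  (forall u v, norm2 (grad phi u - grad phi v) <= L * norm2 (u - v)) ->
  0 < L -> 0 < tau -> 0 < C -> 0 < eps ->
  eps <= 1 / (tau ^+ 2 * n%:R * L * (2 * C + 1)) ->
  0 < delta < 1 -> 0 < gamma < 1 -> 0 < mlo -> mlo <= mhi ->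
  feasible tau (x k) -> ~ stationary phi tau (x k) ->
  as_l1_step phi tau eps delta gamma nm mlo mhi x xt k ->
  exists d : 'rV[R]_n,
    [/\ feasible tau (xt k) /\ feasible tau (x k.+1),
        phi (xt k) <= phi (x k) - C * L * norm2 (xt k - x k) ^+ 2,
        phi (x k.+1) <= reference_value phi nm xt k -
          gamma / mhi * Num.min 1 (2 * delta * (1 - gamma) / (L * mhi)) *
          norm2 d ^+ 2,
        norm2 (x k.+1 - xt k) <= norm2 d
      & let r := - (2 * tau / mlo * norm2 d + 2 * tau * L * norm2 (xt k - x k)
          + (norm2 (grad phi 0) + L * tau) * (norm2 d + norm2 (xt k - x k))) in
        forall i, r <= dotv (grad phi (x k)) (tau *: canonv R i - x k) /\
                  r <= dotv (grad phi (x k)) (- (tau *: canonv R i) - x k)].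
Proof.
move=> dphi lip L0 tau0 C0 eps0 epsle delta01 gamma01 mlo0 mlohi fx nst.
move=> [j [m [alpha [xhat [d [[jmax xtE] [/andP[mlom mmhi] proj] dE ls xE]]]]]].
have jA := argmax_nonactive tau0 eps0 fx nst jmax.
have gj0 := argmax_grad_neq0 fx nst jmax.
have fxt : feasible tau (xt k) by rewrite xtE; exact: shifted_point_feasible.
set N := nonactive_set phi tau eps (x k) in proj dE.
have xtB : restricted_ball tau N (xt k).
  split=> // i; rewrite inE negbK => iA; rewrite xtE mxE iA.
  by case: eqP => // ij; rewrite -ij iA in jA.
have [[fxh xh0] _] := proj.
(* Outside [N] both [xhat] and [xt k] vanish, so the case distinction in [d] disappears. *)
have {}dE : d = xhat - xt k.
  rewrite dE; apply/rowP => i; rewrite !mxE; case: ifP => // /negbT iN.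
  by rewrite xh0 // xtB.2 // subr0.
have conv y : restricted_ball tau N y -> forall t : R, 0 <= t <= 1 ->
    restricted_ball tau N (xhat + t *: (y - xhat)).
  move=> [fy y0] t t01; split; first exact: feasible_segment.
  by move=> i iN; rewrite !mxE xh0 // y0 // subr0 mulr0 addr0.
have m0 : 0 < m := lt_le_trans mlo0 mlom.
have var y : restricted_ball tau N y ->
    0 <= dotv (d + m *: grad phi (xt k)) (y - xhat).
  move=> By; have := projection_variational (conv y By) proj.
  by rewrite dE opprB addrA [xhat + _ - _]addrAC.
(* Test the variational inequality with [y = xt k], then replace [m] by its upper bound [mhi]. *)
have gd : norm2 d ^+ 2 <= - (mhi * dotv (grad phi (xt k)) d).
  have := var _ xtB; rewrite -[xt k - xhat]opprB -dE dotvNr dotvDl dotvZl.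
  rewrite -norm2_sqr; set g := dotv _ d; set q := norm2 d ^+ 2.
  have q0 : 0 <= q by rewrite exprn_ge0.
  move=> H; have : 0 <= - (m * g) by lra.
  rewrite -mulrN pmulr_rge0 // => g0.
  by have := ler_wpM2r g0 mmhi; lra.
have mhi0 : 0 < mhi := lt_le_trans mlo0 mlohi.
have ref : phi (xt k) <= reference_value phi nm xt k.
  by have := reference_value_ge phi xt (leq0n (minn nm k)); rewrite subn0.
have [a01 dec] :=
  line_search_decrease dphi lip L0 delta01 gamma01 mhi0 ref gd ls.
exists d; split.
- by split=> //; rewrite xE dE; exact: feasible_segment.
- by rewrite xtE; exact: shifted_point_decrease epsle fx jmax jA gj0.
- by rewrite xE.
- rewrite xE addrAC subrr add0r -(ler_pXn2r (n := 2)) ?nnegrE //.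
  rewrite !norm2_sqr dotvZl dotvZr mulrA ler_piMl // mulr_ile1 //;
  by case/andP: a01.
have inner (y : 'rV[R]_n) : restricted_ball tau N y ->
    - (2 * tau / mlo * norm2 d + 2 * tau * L * norm2 (xt k - x k)
       + (norm2 (grad phi 0) + L * tau) * (norm2 d + norm2 (xt k - x k)))
    <= dotv (grad phi (x k)) (y - x k).
  move=> By; have fy : feasible tau y := By.1.
  have gap := feasible_gradient_gap (xt k) (x k) (ltW L0) lip fx fxh fy.
  have dd : norm2 (x k - xhat) <= norm2 d + norm2 (xt k - x k).
    rewrite -(norm2N (_ - xhat)) opprB.
    suff -> : xhat - x k = d + (xt k - x k) by exact: norm2D.
    by rewrite dE addrA subrK.
  have G0 : 0 <= norm2 (grad phi 0) + L * tau.
    by rewrite addr_ge0 // mulr_ge0 // ltW.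
  have := ler_wpM2l G0 dd.
  (* The variational inequality bounds [m * gw] below by [- norm2 d * (2 * tau)]; dividing by
     [m >= mlo] makes the constant independent of the iteration. *)
  have : - (2 * tau / mlo * norm2 d) <= dotv (grad phi (xt k)) (y - xhat).
    have := var y By; rewrite dotvDl dotvZl; set gw := dotv (grad _ _) _ => v.
    have dw : dotv d (y - xhat) <= norm2 d * (2 * tau).
      by apply: le_trans (dotv_le _ _) _; rewrite ler_wpM2l ?norm2_subr_feasible.
    set e := 2 * tau / mlo * norm2 d.
    have e0 : 0 <= e by rewrite mulr_ge0 // divr_ge0 ?mulr_ge0 // ltW.
    have me : mlo * e = norm2 d * (2 * tau) by rewrite /e; field; rewrite gt_eqF.
    have := ler_wpM2r e0 mlom; rewrite me => me'.
    have : 0 <= m * (gw + e) by lra.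
    by rewrite pmulr_rge0 //; lra.
  by rewrite -(norm2N (x k - xt k)) opprB in gap; move: gap; lra.
move=> r; have r0 : r <= 0.
  by rewrite oppr_le0 !(addr_ge0, mulr_ge0) ?invr_ge0 // ltW.
(* An active index already has nonnegative values; for any other index both vertices lie in the
   restricted ball, where [inner] applies. *)
move=> i; have [iA|iN] := boolP (i \in active_set phi tau eps (x k)).
  have [H1 H2] := active_vertex_dir (mulr_gt0 eps0 tau0) iA.
  by split; apply: le_trans r0 _.
have [fp fm] := feasible_vertex i tau0.
have off (l : 'I_n) : l \notin N -> (i == l) = false.
  by rewrite inE negbK; apply: contraTF => /eqP <-.
split; apply: inner; split=> // l /off il.
  by rewrite !mxE eq_sym il andbF mulr0.
by rewrite !mxE eq_sym il andbF mulr0 oppr0.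
Qed.

(** * Convergence of the whole run *)

Theorem theorem3p5 (R : realType) (n : nat) (phi : 'rV[R]_n -> R)
  (L tau C eps delta gamma : R) (nm : nat) (mlo mhi : R)
  (x : nat -> 'rV[R]_n) (xstar : 'rV[R]_n)
  (phi_diff : forall y : 'rV[R]_n, differentiable phi y)
  (L_gt0 : 0 < L)
  (grad_lip : forall y z : 'rV[R]_n,
     norm2 (grad phi y - grad phi z) <= L * norm2 (y - z))
  (tau_gt0 : 0 < tau)
  (C_gt0 : 0 < C)
  (eps_gt0 : 0 < eps)
  (eps_le : eps <= 1 / (tau ^+ 2 * n%:R * L * (2 * C + 1)))
  (delta01 : 0 < delta < 1)
  (gamma01 : 0 < gamma < 1)
  (nm_gt0 : (0 < nm)%N)
  (mlo_gt0 : 0 < mlo)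
  (mlo_le_mhi : mlo <= mhi)
  (x_run : as_l1_sequence phi tau eps delta gamma nm mlo mhi x)
  (xstar_limit : cluster (x @ \oo)%classic xstar) :
  stationary phi tau xstar.
Proof.
have [fx0 [xt run]] := x_run.
have L0 := ltW L_gt0.
(* A run that reaches a stationary point is constant from there on, so its limit point is that
   point. *)
have [[k0 st0]|nst] := pselect (exists k, stationary phi tau (x k)).
  have const k : x (k0 + k)%N = x k0.
    elim: k => [|k IH]; first by rewrite addn0.
    by rewrite addnS (run _).1 // IH.
  suff -> : xstar = x k0 by [].
  apply/eqP; rewrite -subr_eq0; apply/eqP/norm2_eq0/eqP.
  rewrite eq_le norm2_ge0 andbT; apply/ler_addgt0Pr => theta theta0.
  have [k /subnKC <- near] := cluster_norm1 k0 xstar_limit theta0.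
  rewrite add0r -(const (k - k0)%N).
  exact: le_trans (norm2_le_norm1 _) near.
have {}nst k : ~ stationary phi tau (x k) by move=> st; apply: nst; exists k.
have prog k fx := as_l1_step_progress phi_diff grad_lip L_gt0 tau_gt0 C_gt0
  eps_gt0 eps_le delta01 gamma01 mlo_gt0 mlo_le_mhi fx (nst k)
  ((run k).2 (nst k)).
have fx k : feasible tau (x k).
  by elim: k => [//|k IH]; have [d [[_ ?] _ _ _ _]] := prog k IH.
have /choice[d Hd] := fun k => prog k (fx k).
have fxt k : feasible tau (xt k) by have [[]] := Hd k.
set c := gamma / mhi * _ in Hd.
have c0 : 0 < c.
  have mhi0 := lt_le_trans mlo_gt0 mlo_le_mhi.
  move/andP: delta01 => [? _]; move/andP: gamma01 => [? ?].
  by rewrite mulr_gt0 ?divr_gt0 // lt_min ltr01 divr_gt0 ?mulr_gt0 ?subr_gt0.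
(* Going from [xt k] to [xt k.+1] takes a line-search move of length at most [norm2 (d k)] and then
   a shift of length [w k.+1]; hence the offset index. *)
pose w k := norm2 (xt k - x k); pose rho k := norm2 (d k) + w k.+1.
set K := norm2 (grad phi 0) + 2 * L * tau.
have K0 : 0 <= K by rewrite addr_ge0 ?mulr_ge0 // ltW.
have lip k : `|phi (xt k.+1) - phi (xt k)| <= K * rho k.
  apply: le_trans (feasible_lipschitz phi_diff L0 grad_lip (fxt _) (fxt _)) _.
  rewrite ler_wpM2l //; have [_ _ _ xd _] := Hd k.
  have -> : xt k.+1 - xt k = (x k.+1 - xt k) + (xt k.+1 - x k.+1).
    by rewrite [RHS]addrC addrA subrK.
  by apply: le_trans (norm2D _ _) _; rewrite lerD2r.
(* The half comes from [(a + b) ^+ 2 <= 2 * (a ^+ 2 + b ^+ 2)], which merges the two decreases into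
   one in [rho k]. *)
pose c' := Num.min c (C * L) / 2.
have c'0 : 0 < c' by rewrite divr_gt0 // lt_min c0 mulr_gt0.
have dec k : phi (xt k.+1) <= reference_value phi nm xt k - c' * rho k ^+ 2.
  have [_ _ dec _ _] := Hd k; have [_ dec' _ _ _] := Hd k.+1.
  have H1 : c' * 2 * norm2 (d k) ^+ 2 <= c * norm2 (d k) ^+ 2.
    by rewrite ler_wpM2r ?exprn_ge0 ?norm2_ge0 // /c' divfK // ge_min lexx.
  have H2 : c' * 2 * w k.+1 ^+ 2 <= C * L * w k.+1 ^+ 2.
    by rewrite ler_wpM2r ?exprn_ge0 ?norm2_ge0 // /c' divfK // ge_min lexx orbT.
  have := mulr_ge0 (ltW c'0) (sqr_ge0 (norm2 (d k) - w k.+1)).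
  by rewrite -/(w _) in dec'; rewrite /rho; lra.
have lb k : phi 0 - K * (2 * tau) <= phi (xt k).
  have f0 : feasible tau (0 : 'rV[R]_n).
    by rewrite /feasible -(scale0r (0 : 'rV[R]_n)) norm1Z normr0 mul0r ltW.
  have := feasible_lipschitz phi_diff L0 grad_lip (fxt k) f0.
  have := ler_wpM2l K0 (norm2_subr_feasible (fxt k) f0).
  by rewrite ler_norml -/K => ? /andP[]; lra.
have rho0 k : 0 <= rho k by rewrite addr_ge0 ?norm2_ge0.
have vanish := nonmonotone_descent_cvg c'0 K0 rho0 lb
  (reference_value_ex phi nm xt)
  (fun k i => @reference_value_ge _ _ phi nm xt k i) dec lip.
apply: (cluster_stationary L0 tau_gt0 grad_lip fx _ xstar_limit) => eta eta0.
set P := 2 * tau / mlo + 2 * tau * L + (norm2 (grad phi 0) + L * tau).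
have P0 : 0 <= P by rewrite !(addr_ge0, mulr_ge0) ?invr_ge0 ?norm2_ge0 // ltW.
have [|k0 Hk0] := vanish (eta / (2 * (P + 1))).
  by rewrite divr_gt0 // mulr_gt0 // ltr_wpDl.
(* At index [k.+1], [rho k] controls [w k.+1] and [rho k.+1] controls [norm2 (d k.+1)], so the
   threshold moves up by one. *)
exists k0.+1 => -[//|k] kk0 i.
have [_ _ _ _ /(_ i)] := Hd k.+1; rewrite /= -/(w _).
set r := - _.
suff : - eta <= r by move=> er [r1 r2]; split; apply: le_trans er _.
rewrite lerN2.
have d0 : 0 <= norm2 (d k.+1) := norm2_ge0 _.
have w0 : 0 <= w k.+1 := norm2_ge0 _.
have sum : norm2 (d k.+1) + w k.+1 <= eta / (P + 1).
  have := Hk0 k kk0; have := Hk0 k.+1 (leqW kk0); rewrite {1}/rho {1}/rho.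
  have -> : eta / (P + 1) = 2 * (eta / (2 * (P + 1))).
    by field; rewrite gt_eqF // ltr_wpDl.
  have := norm2_ge0 (d k); have : 0 <= w k.+2 := norm2_ge0 _.
  by lra.
apply: (@le_trans _ _ (P * (norm2 (d k.+1) + w k.+1))).
  have : 0 <= 2 * tau / mlo * w k.+1 by rewrite !mulr_ge0 ?invr_ge0 // ltW.
  have : 0 <= 2 * tau * L * norm2 (d k.+1) by rewrite !mulr_ge0 // ltW.
  by rewrite /P; lra.
apply: (@le_trans _ _ ((P + 1) * (eta / (P + 1)))).
  by apply: ler_pM => //; [exact: addr_ge0 | rewrite lerDl].
by rewrite mulrCA divff ?mulr1 // gt_eqF // ltr_wpDl.
Qed.
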